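(* Let $\Phi=\{f_i\}_{i\in\Lambda}$ be a finite conformal iterated function system on $\mathbb{R}^t$ of the form $f_i(x)=a_iO_ix+b_i$, where $a_i\in(0,1)$, $b_i\in\mathbb{R}^t$ and $O_i$ is a rotation, which satisfies the strong separation condition and has attractor $X$. Suppose that there exist $i,j\in\Lambda$ such that $a_i\ne a_j$. Let $\psi\colon\mathbb{N}\to[0,\infty)$ be a monotonic decreasing function with shrinking rate $$\alpha=\alpha(\psi)=\liminf_{n\to\infty}-\frac{\log\psi(n)}{n}\in(0,\infty).$$ Let $s$ be the (unique) solution of $\sum_{i\in\Lambda}e^{-\alpha s}a_i^s=1$, and write $d=\dim_{\mathrm H}X$ (so that $d$ is the unique solution of $\sum_{i\in\Lambda}a_i^d=1$). Let $x\in X$ and $\Psi(\mathbf{i})=\mathrm{diam}(X_{\mathbf{i}})\psi(|\mathbf{i}|)$ for $\mathbf{i}\in\Lambda^*$. Then $$\mathcal{H}^d\big(W(x,\Psi^{s/d})\big)=0.$$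
   Context: $\mathbb{N}=\{0,1,2,\dots\}$; $\mathcal{H}^d$ is Hausdorff $d$-measure and $\dim_{\mathrm H}$ Hausdorff dimension. A norm $\|\cdot\|$ on $\mathbb{R}^t$ is fixed; conformality of $\Phi$ with respect to it means here that $\|O_iy\|=\|y\|$ for all $y\in\mathbb{R}^t$, so each $f_i$ is a similarity with ratio $a_i$. The attractor $X$ is the unique non-empty compact set with $X=\bigcup_{i\in\Lambda}f_i(X)$. $\Lambda^*=\bigcup_{n\ge0}\Lambda^n$, $|\mathbf{i}|$ is the length of the word $\mathbf{i}$, $f_{\mathbf{i}}=f_{i_1}\circ\cdots\circ f_{i_{|\mathbf{i}|}}$, $f_\emptyset=\mathrm{id}$, $X_{\mathbf{i}}=f_{\mathbf{i}}(X)$. Strong separation condition: $f_i(X)\cap f_j(X)=\emptyset$ for all $i\neq j$ in $\Lambda$. For a function $\Theta\colon\Lambda^*\to[0,\infty)$, $W(x,\Theta)=\{y\in X:\|y-f_{\mathbf{i}}(x)\|<\Theta(\mathbf{i})\text{ for infinitely many }\mathbf{i}\in\Lambda^*\}$. $\Psi^{u}$ denotes the function $\mathbf{i}\mapsto\Psi(\mathbf{i})^{u}$. Convention: $-\log 0=+\infty$. *)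

(* Defs.v *)
From HB Require Import structures.
From mathcomp Require Import all_boot all_order all_algebra.
From mathcomp Require Import all_classical all_reals all_analysis.

Set Implicit Arguments.
Unset Strict Implicit.
Unset Printing Implicit Defensive.

Import Order.TTheory GRing.Theory Num.Theory.
Import numFieldNormedType.Exports.

Local Open Scope classical_set_scope.
Local Open Scope ring_scope.

(* The canonical norm of 'cV[R]_t is the sup norm, so an arbitrary norm on R^t
   is an explicit function N; all metric notions below refer to N.  The
   canonical topology of 'cV[R]_t is the one induced by any such N. *)
Record is_norm (R : realType) (t : nat) (N : 'cV[R]_t -> R) : Prop := IsNorm {
  norm_eq0 : forall x, N x = 0 -> x = 0 ;
  norm_homo : forall (c : R) x, N (c *: x) = `|c| * N x ;
  norm_triangle : forall x y, N (x + y) <= N x + N y }.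

(* Q \in SO(t) *)
Definition is_rotation (R : realType) (t : nat) (Q : 'M[R]_t) : Prop :=
  Q *m Q^T = 1%:M /\ \det Q = 1.

Section Hausdorff.
Context {R : realType} {t : nat}.
Variable N : 'cV[R]_t -> R.
Local Open Scope ereal_scope.

(* The maximum with 0 only matters for the empty set. *)
Definition diam (U : set 'cV[R]_t) : \bar R :=
  maxe 0 (ereal_sup [set (N (z.1 - z.2))%:E | z in U `*` U]).

(* The empty set has gauge 0 also for s = 0, where 0 `^ 0 = 1. *)
Definition gauge (s : R) (U : set 'cV[R]_t) : \bar R :=
  if U == set0 then 0 else diam U `^ s.

Definition hausdorff_content (s delta : R) (A : set 'cV[R]_t) : \bar R :=
  ereal_inf [set \sum_(k <oo) gauge s (U k) | U in
    [set U : nat -> set 'cV[R]_t |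
      A `<=` \bigcup_k U k /\ forall k, diam (U k) <= delta%:E]].

Definition hausdorff_measure (s : R) (A : set 'cV[R]_t) : \bar R :=
  ereal_sup [set hausdorff_content s delta A | delta in [set r : R | (0 < r)%R]].

Definition hausdorff_dim (A : set 'cV[R]_t) : \bar R :=
  ereal_inf [set s%:E | s in
    [set s : R | (0 <= s)%R /\ hausdorff_measure s A = 0]].

End Hausdorff.

Section IFS.
Context {R : realType} {t : nat} {L : finType}.

Definition affine_map (a : R) (Q : 'M[R]_t) (b x : 'cV[R]_t) : 'cV[R]_t :=
  a *: (Q *m x) + b.

Variable f : L -> 'cV[R]_t -> 'cV[R]_t.

Definition is_attractor (X : set 'cV[R]_t) : Prop :=
  [/\ X !=set0, compact X & X = \bigcup_(i in [set: L]) (f i @` X)].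

Definition strong_separation (X : set 'cV[R]_t) : Prop :=
  forall i j : L, i != j -> (f i @` X) `&` (f j @` X) = set0.

Definition word_map (w : seq L) : 'cV[R]_t -> 'cV[R]_t :=
  foldr (fun i g => f i \o g) id w.

Definition limsup_set (N : 'cV[R]_t -> R) (X : set 'cV[R]_t) (x : 'cV[R]_t)
    (Theta : seq L -> R) : set 'cV[R]_t :=
  [set y | X y /\ infinite_set [set w | N (y - word_map w x) < Theta w]].

(* The N-diameter of X_w is finite, X being compact. *)
Definition target_radius (N : 'cV[R]_t -> R) (X : set 'cV[R]_t)
    (psi : nat -> R) (w : seq L) : R :=
  fine (diam N (word_map w @` X)) * psi (size w).

End IFS.

(* lne 0 = -oo, so a zero of psi contributes +oo. *)
Definition shrinking_rate (R : realType) (psi : nat -> R) : \bar R :=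
  limn_einf (fun n : nat => - lne (psi n)%:E * (n%:R^-1)%:E)%E.

(* Main.v *)
Require Import Defs.
From mathcomp Require Import all_boot all_order all_algebra.
From mathcomp Require Import all_classical all_reals all_analysis.
From mathcomp Require Import lra ring zify.
Import Order.TTheory GRing.Theory Num.Theory.
Import numFieldNormedType.Exports.
Local Open Scope classical_set_scope.
Local Open Scope ring_scope.

(* Let p_i = e^(- alpha s) a_i^s and mu_i = a_i^d.  Then sum p_i = 1, and
   sum mu_i <= 1 by the strong separation condition.  As the ratios differ,
   p <> mu, so sum sqrt (p_i mu_i) < 1.  The ball attached to a word w of length
   n has radius r_w with r_w^d <= K p_w e^(eps n).  Where r_w <= a_w this ball is
   used as it is; otherwise it is contained in a ball of radius comparable to
   a_v, for the prefix v of w at which a_v drops below r_w.  So w = v u, with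
   u empty in the first case, and the d-th power of the radius used is at
   most a constant times
     e^(eps n / 2) sqrt (p_v mu_v) (max_i sqrt p_i)^|u|,
   which depends only on v and |u|.  For small eps this is summable over all
   pairs (v, |u|), so the limsup set is null by Borel-Cantelli. *)

(** * Weights of words, cuts of the tree of words, and geometric sums *)

Section Words.
Context {R : realType} {L : finType}.
Implicit Types (p q : L -> R) (v w : seq L) (V : seq (seq L)).

(** The multiplicative extension of a letter weight to words: p_w, a_w and mu_w of the overview. *)
Definition weight p w : R := \prod_(i <- w) p i.

Lemma weight_cat p v w : weight p (v ++ w) = weight p v * weight p w.
Proof. by rewrite /weight big_cat. Qed.

Lemma weight_rcons p v i : weight p (rcons v i) = weight p v * p i.
Proof. by rewrite /weight -cats1 big_cat big_seq1. Qed.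

Lemma weightM p q w : weight (fun i => p i * q i) w = weight p w * weight q w.
Proof. by rewrite /weight big_split. Qed.

Lemma weight_cst (c : R) w : weight (fun=> c) w = c ^+ size w.
Proof.
elim: w => [|i w IH]; first by rewrite /weight big_nil.
by rewrite /weight big_cons -/(weight _ _) IH exprS.
Qed.

Lemma weight_powR p (s : R) w : (forall i, 0 <= p i) ->
  weight (fun i => p i `^ s) w = weight p w `^ s.
Proof.
move=> p0; elim: w => [|i w IH]; first by rewrite /weight !big_nil powR1.
rewrite /weight !big_cons -!/(weight _ _) IH powRM//.
by apply: prodr_ge0.
Qed.

Lemma weight_ge0 p w : (forall i, 0 <= p i) -> 0 <= weight p w.
Proof. by move=> p0; apply: prodr_ge0. Qed.

Lemma weight_gt0 p w : (forall i, 0 < p i) -> 0 < weight p w.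
Proof. by move=> p0; apply: prodr_gt0. Qed.

Lemma ler_weight p q w : (forall i, 0 <= p i <= q i) -> weight p w <= weight q w.
Proof. by move=> pq; apply: ler_prod. Qed.

(** The branch of V below the letter i, with that letter removed. It lets sums over V be treated by
    recursion on the first letter. *)
Definition tails i V : seq (seq L) :=
  pmap (fun v => if v is j :: v' then (if j == i then Some v' else None)
                 else None) V.

Lemma mem_tails i V v : (v \in tails i V) = (i :: v \in V).
Proof.
elim: V => //= -[|j w] V IH; rewrite in_cons ?eqseq_cons /=; first by rewrite IH.
by rewrite [i == j]eq_sym; case: ifP => /= ji; rewrite ?in_cons IH.
Qed.

Lemma tails_uniq i V : uniq V -> uniq (tails i V).
Proof.
by apply: (@pmap_uniq _ _ _ (cons i)) => -[|j v] //=; case: eqVneq => //= ->.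
Qed.

Lemma sum_tails (F : seq L -> R) V :
  \sum_(v <- V) F v =
  \sum_(v <- V | v == [::]) F v + \sum_i \sum_(v <- tails i V) F (i :: v).
Proof.
elim: V => [|v V IH].
  by rewrite !big_nil add0r big1// => i _; rewrite big_nil.
rewrite !big_cons IH; case: v => [|j v] /=; first by rewrite addrA.
rewrite addrCA; congr +%R.
rewrite (bigD1 j)//= [RHS](bigD1 j)//= eqxx big_cons addrA; congr +%R.
by apply: eq_bigr => i /negbTE; rewrite eq_sym => ->.
Qed.

Lemma sum_weight_tails p V :
  \sum_(v <- V) weight p v =
  \sum_(v <- V | v == [::]) 1 + \sum_i p i * \sum_(v <- tails i V) weight p v.
Proof.
rewrite sum_tails; congr +%R.
  by apply: eq_bigr => v /eqP ->; rewrite /weight big_nil.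
apply: eq_bigr => i _; rewrite mulr_sumr; apply: eq_bigr => v _.
by rewrite /weight big_cons.
Qed.

(** Induction on the depth n of the cut. If V contains the empty word, its weight 1 suffices;
    otherwise each branch [tails i V] is a cut at depth n - 1, and the bounds for the branches are
    averaged with the weights p i. *)
Lemma sum_weight_prefix_ge1 p n V : (forall i, 0 <= p i) -> 1 <= \sum_i p i ->
  (forall w, size w = n -> exists2 v, v \in V & prefix v w) ->
  1 <= \sum_(v <- V) weight p v.
Proof.
move=> p0 p1; elim: n V => [|n IH] V HV.
  have [v vV] := HV [::] erefl; rewrite prefixs0 => /eqP v0.
  rewrite (big_rem _ vV) /= v0 {1}/weight big_nil lerDl.
  by apply: sumr_ge0 => w _; exact: weight_ge0.
have [nilV|nilV] := boolP ([::] \in V).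
  rewrite (big_rem _ nilV) /= {1}/weight big_nil lerDl.
  by apply: sumr_ge0 => w _; exact: weight_ge0.
rewrite sum_weight_tails ler_wpDl//; first exact: sumr_ge0.
apply: (le_trans p1); apply: ler_sum => i _; rewrite ler_peMr//.
apply: IH => w wn; have [|v vV vw] := HV (i :: w); first by rewrite /= wn.
case: v vV vw => [|j v] vV; first by rewrite vV in nilV.
rewrite prefix_cons => /andP[/eqP ji vw].
by exists v => //; rewrite mem_tails -ji.
Qed.

(** The weights of all words add up to the geometric series in the sum P of the p i. The induction,
    on a bound for the lengths, uses that C = (1 - P)^-1 solves C = 1 + P C; uniqueness of V makes
    the empty word count at most once. *)
Lemma sum_weight_uniq_le p V : (forall i, 0 <= p i) -> \sum_i p i < 1 ->
  uniq V -> \sum_(v <- V) weight p v <= (1 - \sum_i p i)^-1.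
Proof.
move=> p0 p1; have S0 : 0 < 1 - \sum_i p i by rewrite subr_gt0.
have : exists n, forall v, v \in V -> (size v < n)%N.
  exists (\max_(v <- V) size v).+1 => v vV.
  by rewrite ltnS (leq_bigmax_seq v).
move=> [n]; elim: n V => [|n IH] V HV uV.
  case: V HV uV => [|v V] HV _; first by rewrite big_nil invr_ge0 ltW.
  by have := HV v (mem_head _ _).
rewrite sum_weight_tails.
have -> : (1 - \sum_i p i)^-1 = 1 + \sum_i p i * (1 - \sum_i p i)^-1.
  rewrite -mulr_suml; move: S0; move: (\sum_i p i) => S S0.
  by field; rewrite gt_eqF.
apply: lerD.
  rewrite -big_filter.
  have -> : [seq v <- V | v == [::]] = if [::] \in V then [:: [::]] else [::].
    elim: V uV {IH HV} => //= v V IH /andP[vV /IH ->].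
    by rewrite in_cons; case: v vV => //= /negbTE ->.
  by case: ifP => _; rewrite ?big_seq1 ?big_nil.
apply: ler_sum => i _; apply: ler_wpM2l => //; apply: IH.
  by move=> v; rewrite mem_tails => /HV.
exact: tails_uniq.
Qed.

End Words.

Lemma sum_geometric_pairs_le {R : realFieldType} {T : eqType} {A : T -> R}
    {B theta : R} {s : seq (T * nat)} :
  (forall v, 0 <= A v) -> 0 <= theta < 1 ->
  (forall V, uniq V -> \sum_(v <- V) A v <= B) -> uniq s ->
  \sum_(z <- s) A z.1 * theta ^+ z.2 <= B / (1 - theta).
Proof.
move=> A0 /andP[theta0 theta1] AB us.
have B0 : 0 <= B by have := AB [::] isT; rewrite big_nil.
pose n := (\max_(z <- s) z.2).+1.
(* The pairs are grouped by their second component j; within a group the first components are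
   distinct, so the bound B applies to each group. *)
rewrite (_ : \sum_(z <- s) _ =
    \sum_(j < n) \sum_(z <- s | z.2 == j :> nat) A z.1 * theta ^+ j); last first.
  rewrite (exchange_big_dep xpredT)//= big_seq [RHS]big_seq; apply: eq_bigr => z zs.
  have zn : (z.2 < n)%N by rewrite ltnS (leq_bigmax_seq z (F := snd)).
  by rewrite (big_pred1 (Ordinal zn)) // => j; rewrite eq_sym.
apply: (@le_trans _ _ (\sum_(j < n) B * theta ^+ j)).
  apply: ler_sum => j _; rewrite -mulr_suml; apply: ler_wpM2r.
    exact: exprn_ge0.
  rewrite -big_filter -(big_map fst xpredT A); apply: AB.
  rewrite map_inj_in_uniq ?filter_uniq// => -[v k] [w l].
  by rewrite !mem_filter /= => /andP[/eqP -> _] /andP[/eqP -> _] ->.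
rewrite -mulr_sumr; apply: ler_wpM2l => //.
have theta10 : 0 < 1 - theta by rewrite subr_gt0.
rewrite -(ler_pM2l theta10) divff ?gt_eqF//.
have := subrX1 theta n; have := exprn_ge0 n theta0.
set S := \sum_(j < n) _; lra.
Qed.

(** * Norms on R^t: continuity and diameters *)

Section Norms.
Context {R : realType} {t : nat} (N : 'cV[R]_t -> R) (HN : is_norm N).
Implicit Types (x y z : 'cV[R]_t) (U A : set 'cV[R]_t).

Lemma is_norm0 : N 0 = 0.
Proof. by have := norm_homo HN 0 0; rewrite scale0r normr0 mul0r. Qed.

Lemma is_normN x : N (- x) = N x.
Proof. by rewrite -scaleN1r (norm_homo HN) normrN1 mul1r. Qed.

Lemma is_norm_distC x y : N (x - y) = N (y - x).
Proof. by rewrite -is_normN opprB. Qed.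

Lemma is_norm_ge0 x : 0 <= N x.
Proof.
have := norm_triangle HN x (- x); rewrite subrr is_norm0 is_normN -mulr2n.
by rewrite pmulrn_lge0.
Qed.

Lemma is_norm_dist_triangle x y z : N (x - z) <= N (x - y) + N (y - z).
Proof. by have := norm_triangle HN (x - y) (y - z); rewrite addrA subrK. Qed.

Lemma is_norm_ler_dist x y : `|N x - N y| <= N (x - y).
Proof.
rewrite ler_norml; apply/andP; split.
  rewrite lerNl opprB lerBlDl is_norm_distC.
  by have := norm_triangle HN x (y - x); rewrite addrC subrK addrC.
by rewrite lerBlDr; have := norm_triangle HN (x - y) y; rewrite subrK.
Qed.

(** Expansion in the standard basis. This comparison with the sup norm makes N continuous for the
    canonical topology, so that compactness arguments apply to N-distances. *)
Lemma is_norm_le_mx_norm x : N x <= `|x| * \sum_j N (delta_mx j 0).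
Proof.
have H (I : Type) (r : seq I) (F : I -> 'cV[R]_t) :
    N (\sum_(j <- r) F j) <= \sum_(j <- r) N (F j).
  elim: r => [|j r IH]; first by rewrite !big_nil is_norm0.
  by rewrite !big_cons; apply: (le_trans (norm_triangle HN _ _)); rewrite lerD2l.
rewrite [in X in N X](matrix_sum_delta x).
under eq_bigr do rewrite big_ord1.
apply: (le_trans (H _ _ _)); rewrite mulr_sumr; apply: ler_sum => j _.
rewrite (norm_homo HN) ler_wpM2r ?is_norm_ge0//.
rewrite [`|x|]mx_normrE.
exact: (@le_bigmax _ _ _ _ (fun i : 'I_t * 'I_1 => `|x i.1 i.2|) (j, 0)).
Qed.

Lemma is_norm_continuous : continuous N.
Proof.
move=> x; apply/(@cvgrPdist_lt _ _ _ (nbhs x) (nbhs_filter x)) => e e0.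
pose B := \sum_j N (delta_mx j 0) + 1.
have B0 : 0 < B by rewrite ltr_wpDl// sumr_ge0// => j _; exact: is_norm_ge0.
near=> y.
apply: (le_lt_trans (is_norm_ler_dist _ _)).
apply: (le_lt_trans (is_norm_le_mx_norm _)).
apply: (@le_lt_trans _ _ (`|x - y| * B)).
  by rewrite ler_wpM2l// lerDl.
rewrite -ltr_pdivlMr//; near: y.
by apply: (@cvgr_dist_lt _ _ _ (nbhs x) (nbhs_filter x) id x); rewrite ?divr_gt0.
Unshelve. all: by end_near. Qed.

Lemma mulmx_continuous (Q : 'M[R]_t) : continuous (fun x => Q *m x).
Proof.
have -> : (fun x => Q *m x) = (fun x => \sum_j x j 0 *: col j Q).
  apply/funext => x; apply/matrixP => i j.
  rewrite mxE summxE; apply: eq_bigr => k _.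
  by rewrite !mxE (ord1 j) mulrC.
elim: (index_enum _) => [|j r IH] x.
  under eq_fun do rewrite big_nil.
  exact: cst_continuous.
rewrite [X in continuous_at _ X](_ : _ =
    (fun y => y j 0 *: col j Q) \+ (fun y => \sum_(k <- r) y k 0 *: col k Q)).
  apply: continuousD; last exact: IH.
  by apply: continuousZr_tmp; exact: coord_continuous.
by apply/funext => y; rewrite big_cons.
Qed.

Lemma affine_map_continuous a (Q : 'M[R]_t) b : continuous (affine_map a Q b).
Proof.
move=> x; apply: (@continuousD _ _ _ (a \*: mulmx Q) (cst b)).
  by apply: continuousZl_tmp; exact: mulmx_continuous.
exact: cst_continuous.
Qed.

Lemma diam_ubP U (r : R) : 0 <= r ->
  (diam N U <= r%:E)%E <-> forall y z, U y -> U z -> N (y - z) <= r.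
Proof.
move=> r0; rewrite /diam ge_max lee_fin r0 /=; split=> [H y z Uy Uz|H].
  rewrite -lee_fin; apply: le_trans H.
  by apply: ereal_sup_ubound; exists (y, z).
by apply: ge_ereal_sup => _ [[y z] /= [Uy Uz] <-]; rewrite lee_fin H.
Qed.

Lemma diam_ge0 U : (0 <= diam N U)%E.
Proof. by rewrite /diam le_max lexx. Qed.

End Norms.

(** * Hausdorff measure: covers of null sets and a Borel-Cantelli criterion *)

Section HausdorffMeasure.
Context {R : realType} {t : nat} (N : 'cV[R]_t -> R).
Implicit Types (U A : set 'cV[R]_t).
Local Open Scope ereal_scope.

Lemma gauge_ge0 s U : 0 <= gauge N s U.
Proof. by rewrite /gauge; case: ifP => // _; exact: poweR_ge0. Qed.

Lemma gauge_le s U (r : R) : (0 <= s)%R -> (0 <= r)%R ->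
  (forall y z, U y -> U z -> (N (y - z) <= r)%R) ->
  gauge N s U <= (r `^ s)%:E.
Proof.
move=> s0 r0 HU; rewrite /gauge; case: ifP => [_|_].
  by rewrite lee_fin powR_ge0.
rewrite -poweR_EFin; apply: gt0_ler_poweR => //.
- by rewrite in_itv /= diam_ge0 leey.
- by rewrite in_itv /= lee_fin r0 leey.
- exact/diam_ubP.
Qed.

Lemma hausdorff_content_ge0 s delta A : 0 <= hausdorff_content N s delta A.
Proof.
apply: le_ereal_inf_tmp => _ [U _ <-].
by apply: nneseries_ge0 => n _ _; exact: gauge_ge0.
Qed.

Lemma hausdorff_measure0_cover s A (e : R) : (0 < e)%R ->
  hausdorff_measure N s A = 0 ->
  exists U : nat -> set 'cV[R]_t,
    [/\ A `<=` \bigcup_k U k, forall k, diam N (U k) <= 1 &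
        \sum_(k <oo) gauge N s (U k) < e%:E].
Proof.
move=> e0 A0.
have : hausdorff_content N s 1 A < e%:E.
  apply: (@le_lt_trans _ _ 0); last by rewrite lte_fin.
  by rewrite -A0; apply: ereal_sup_ubound; exists 1%R => //=.
by move=> /ereal_inf_lt[_ [U [AU U1] <-] Ue]; exists U.
Qed.

(* The gauge sums of the tails tend to 0, and so do the diameters, every
   single term being bounded by its tail. *)
Lemma hausdorff_measure_limsup0 (s B : R) A (E : nat -> set 'cV[R]_t)
    (r : nat -> R) : (0 < s)%R -> (forall k, 0 <= r k)%R ->
  (forall k y z, E k y -> E k z -> (N (y - z) <= r k)%R) ->
  (forall n, \sum_(0 <= k < n) r k `^ s <= B)%R ->
  (forall y, A y -> forall n, exists2 k, (n <= k)%N & E k y) ->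
  hausdorff_measure N s A = 0.
Proof.
move=> s0 r0 Er rB AE.
pose u k := (r k `^ s)%:E.
have u0 k : 0 <= u k by rewrite lee_fin powR_ge0.
have uB : \sum_(0 <= k <oo) u k < +oo.
  apply: (@le_lt_trans _ _ B%:E); last exact: ltry.
  apply: lime_le; first by apply: is_cvg_nneseries => n _ _; exact: u0.
  by apply: nearW => n; rewrite sumEFin lee_fin.
have tail := nneseries_tail_cvg uB (fun k _ => u0 k).
have small (e : R) : (0 < e)%R -> exists n, \sum_(n <= k <oo) u k < e%:E.
  move=> e0; have /tail [n _ /(_ n)] : nbhs (0 : \bar R) [set x | x < e%:E].
    apply: (@open_nbhs_nbhs _ 0); split; first exact: open_ereal_lt_ereal.
    by rewrite /= lte_fin.
  by move=> H; exists n; apply: H => /=.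
have content0 delta : (0 < delta)%R -> hausdorff_content N s delta A = 0.
  move=> delta0; apply/eqP; rewrite eq_le hausdorff_content_ge0 andbT.
  apply/lee_addgt0Pr => e e0; rewrite add0e.
  (* The bound e controls the gauge sum of the tail; the bound delta^s forces every [r k] of the
     tail to be at most delta. *)
  have [|n ne] := small (Num.min e (delta `^ s))%R; first by rewrite lt_min e0 powR_gt0.
  rewrite -nneseries_addn// in ne.
  apply: (@le_trans _ _ (\sum_(k <oo) u (k + n)%N)); last first.
    by apply/ltW/(lt_le_trans ne); rewrite lee_fin ge_min lexx.
  apply: ge_ereal_inf; exists (\sum_(k <oo) gauge N s (E (k + n)%N)); last first.
    apply: lee_nneseries => [k _ _|k _]; first exact: gauge_ge0.
    by apply: gauge_le (ltW s0) (r0 _) _; exact: Er.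
  exists (fun k => E (k + n)%N) => //; split=> [y Ay|k].
    have [k nk Eky] := AE y Ay n.
    by exists (k - n)%N => //=; rewrite subnK.
  apply/diam_ubP; first exact: ltW.
  move=> y z Ey Ez; apply: (le_trans (Er _ _ _ Ey Ez)).
  rewrite leNgt; apply/negP => delta_lt.
  have : u (k + n)%N < (delta `^ s)%:E.
    apply: (@le_lt_trans _ _ (\sum_(k <oo) u (k + n)%N)); last first.
      by apply: (lt_le_trans ne); rewrite lee_fin ge_min lexx orbT.
    apply: le_trans (nneseries_lim_ge k.+1 (fun j _ _ => u0 _)).
    by rewrite big_nat_recr//= leeDr// sume_ge0.
  rewrite lte_fin ltNge ge0_ler_powR ?nnegrE// ltW//.
apply/eqP; rewrite eq_le; apply/andP; split.
  by apply: ge_ereal_sup => _ [delta delta0 <-]; rewrite content0.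
by rewrite -(content0 1%R ltr01); apply: ereal_sup_ubound; exists 1%R => //=.
Qed.

End HausdorffMeasure.

(** * Consequences of the shrinking rate, and two finiteness facts *)

Lemma limn_einf_gt {R : realType} {u : nat -> \bar R} {x : \bar R} :
  (x < limn_einf u)%E -> exists n0, forall n, (n0 <= n)%N -> (x < u n)%E.
Proof.
rewrite limn_einf_lim; have /cvg_lim -> // := @cvg_einfs_sup _ u.
move=> /ereal_sup_gt[_ [n0 _ <-] xn0]; exists n0 => n n0n.
by apply: (lt_le_trans xn0); apply: ereal_inf_lbound; exists n.
Qed.

Lemma shrinking_rate_lt {R : realType} {psi : nat -> R} {beta : R} :
  (forall n, 0 <= psi n) -> (beta%:E < shrinking_rate psi)%E ->
  exists n0, forall n, (n0 <= n)%N -> psi n <= expR (- beta * n%:R).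
Proof.
(* The successor makes n positive, so that the division by n can be undone. Zeros of psi are treated
   apart, because [lne] is infinite there. *)
move=> psi0 /limn_einf_gt[n0 Hn0]; exists n0.+1 => n n0n.
have [->|psin] := eqVneq (psi n) 0; first by rewrite ltW// expR_gt0.
have psi_gt0 : 0 < psi n by rewrite lt0r psin psi0.
have := Hn0 n (ltnW n0n).
rewrite lne_EFin// -EFinN -EFinM lte_fin ltr_pdivlMr; last by rewrite ltr0n; lia.
by move=> H; rewrite -[psi n]lnK ?posrE// ler_expR mulNr ltW// ltrNr.
Qed.

Lemma finite_words (L : finType) n : finite_set [set w : seq L | (size w <= n)%N].
Proof.
have H k : finite_set [set w : seq L | size w = k].
  apply: (@sub_finite_set _ _ ((@tval k L) @` setT)); last exact: finite_image.
  by move=> w /= /eqP wk; exists (Tuple wk).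
apply: (@sub_finite_set _ _ (\bigcup_(k in `I_n.+1) [set w : seq L | size w = k])).
  by move=> w /= wn; exists (size w).
by apply: bigcup_finite => [|k _]; [exact: finite_II|exact: H].
Qed.

Lemma finite_pos_lower_bound {R : realFieldType} {T : finType} {c : T -> R} :
  (forall i, 0 < c i) -> exists2 m, 0 < m < 1 & forall i, m <= c i.
Proof.
(* The initial value 1/2 keeps the minimum below 1 and covers an empty index type. *)
move=> c0; exists (\big[Num.min/2^-1]_i c i).
  apply/andP; split; first by apply: lt_bigmin => [|i _]; rewrite ?invr_gt0.
  by apply: (@le_lt_trans _ _ 2^-1); [exact: bigmin_le_id|lra].
by move=> i; exact: bigmin_le.
Qed.

(** * Cylinders of the attractor *)

Section Cylinders.
Context {R : realType} {t : nat} {L : finType}.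
Variables (N : 'cV[R]_t -> R) (a : L -> R) (f : L -> 'cV[R]_t -> 'cV[R]_t).
Variable X : set 'cV[R]_t.
Hypothesis HN : is_norm N.
Hypothesis a01 : forall i, 0 < a i < 1.
Hypothesis f_sim : forall i y z, N (f i y - f i z) = a i * N (y - z).
Hypothesis f_cont : forall i, continuous (f i).
Hypothesis HX : is_attractor f X.
Implicit Types (v w : seq L) (U : set 'cV[R]_t).

Definition cylinder w : set 'cV[R]_t := word_map f w @` X.

Lemma word_map_cat v w y : word_map f (v ++ w) y = word_map f v (word_map f w y).
Proof. by elim: v => //= i v ->. Qed.

Lemma ratio_gt0 i : 0 < a i.
Proof. by case/andP: (a01 i). Qed.

Lemma ratio_ge0 i : 0 <= a i.
Proof. exact/ltW/ratio_gt0. Qed.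

Lemma ratio_lt1 i : a i < 1.
Proof. by case/andP: (a01 i). Qed.

Lemma word_map_dist w y z :
  N (word_map f w y - word_map f w z) = weight a w * N (y - z).
Proof.
elim: w => [|i w IH] /=; first by rewrite /weight big_nil mul1r.
by rewrite f_sim IH /weight big_cons mulrA.
Qed.

Lemma attractor_map i y : X y -> X (f i y).
Proof. by case: HX => _ _ {2}-> Xy; exists i => //; exists y. Qed.

Lemma attractor_word w y : X y -> X (word_map f w y).
Proof. by move=> Xy; elim: w => //= i w; exact: attractor_map. Qed.

Lemma cylinder_cat v w : cylinder (v ++ w) `<=` cylinder v.
Proof.
move=> _ [y Xy <-]; rewrite word_map_cat; exists (word_map f w y) => //.
exact: attractor_word.
Qed.

Lemma cylinder_rcons v y : cylinder v y -> exists i, cylinder (rcons v i) y.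
Proof.
case: HX => _ _ XE [z Xz <-]; move: Xz; rewrite {1}XE => -[i _ [x Xx <-]].
by exists i, x => //; rewrite -cats1 word_map_cat.
Qed.

Lemma word_map_continuous w : continuous (word_map f w).
Proof.
elim: w => [|i w IH] y /=; first exact: cvg_id.
by apply: continuous_comp; [exact: IH|exact: f_cont].
Qed.

Lemma cylinder_compact w : compact (cylinder w).
Proof.
case: HX => _ cX _; apply: continuous_compact => //.
by apply: continuous_subspaceT; exact: word_map_continuous.
Qed.

Lemma cylinder_closed w : closed (cylinder w).
Proof. by apply: compact_closed; [exact: norm_hausdorff|exact: cylinder_compact]. Qed.

Lemma is_norm_dist_continuous :
  continuous (fun p : 'cV[R]_t * 'cV[R]_t => N (p.1 - p.2)).
Proof.
move=> p; apply: (@continuous_comp _ _ _ (fun p : 'cV[R]_t * 'cV[R]_t => p.1 - p.2) N).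
  exact: sub_continuous.
exact: is_norm_continuous.
Qed.

Lemma attractor_bounded :
  exists2 M, 0 < M & forall y z, X y -> X z -> N (y - z) <= M.
Proof.
case: HX => -[x0 Xx0] cX _.
have [|p _ pM] := @compact_EVT_max _ R _ (X `*` X) _ (compact_setX cX cX)
  (continuous_subspaceT is_norm_dist_continuous).
  by exists (x0, x0).
exists (N (p.1 - p.2) + 1); first by rewrite ltr_wpDl// is_norm_ge0.
move=> y z Xy Xz; apply: ler_wpDr => //.
by apply: (pM (y, z)); rewrite inE.
Qed.

(** * Strong separation and the lower bound for Hausdorff measure *)

Hypothesis Hsep : strong_separation f X.

(** Strong separation forces equal first letters; these are then cancelled, since a map scaling
    distances by a positive ratio is injective. *)
Lemma cylinder_disjoint v w y :
  size v = size w -> cylinder v y -> cylinder w y -> v = w.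
Proof.
elim: v w y => [|i v IH] [|j w] // y [vw] [y1 Xy1 y1E] [y2 Xy2 y2E].
have [ij|ij] := eqVneq i j; last first.
  suff : ((f i @` X) `&` (f j @` X)) y by rewrite (Hsep _ _ ij).
  by split; [exists (word_map f v y1)|exists (word_map f w y2)] => //;
    exact: attractor_word.
rewrite ij; congr cons; apply: (IH w (word_map f v y1)) => //; first by exists y1.
exists y2 => //; apply/eqP; rewrite -subr_eq0; apply/eqP/(norm_eq0 HN).
apply: (mulfI (lt0r_neq0 (ratio_gt0 i))).
rewrite -f_sim mulr0 {1}ij.
have -> : f j (word_map f w y2) = f i (word_map f v y1) by rewrite [LHS]y2E -y1E.
by rewrite subrr is_norm0.
Qed.

(** On each product of two distinct pieces, compact and disjoint, the distance attains a positive
    minimum; there are finitely many pairs of letters. *)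
Lemma separation_gap : exists2 c, 0 < c & forall i j y z,
  i != j -> X y -> X z -> c <= N (f i y - f j z).
Proof.
have gap (p : L * L) : exists c, 0 < c /\ forall y z,
    p.1 != p.2 -> X y -> X z -> c <= N (f p.1 y - f p.2 z).
  have [ij|ij] := eqVneq p.1 p.2; first by exists 1; split.
  case: (HX) => -[x0 Xx0] cX _.
  have cfX i : compact (f i @` X).
    by apply: continuous_compact => //; apply: continuous_subspaceT; exact: f_cont.
  have [|q /set_mem[Xq1 Xq2] qmin] := @compact_EVT_min _ R _
    ((f p.1 @` X) `*` (f p.2 @` X)) _ (compact_setX (cfX _) (cfX _))
    (continuous_subspaceT is_norm_dist_continuous).
    by exists (f p.1 x0, f p.2 x0); split; exists x0.
  exists (N (q.1 - q.2)); split; last first.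
    move=> y z _ Xy Xz; apply: (qmin (f p.1 y, f p.2 z)).
    by rewrite inE; split; [exists y|exists z].
  rewrite lt0r is_norm_ge0// andbT; apply/eqP => /(norm_eq0 HN)/eqP.
  rewrite subr_eq0 => /eqP q12.
  suff : ((f p.1 @` X) `&` (f p.2 @` X)) q.1 by rewrite (Hsep _ _ ij).
  by split => //; rewrite q12.
have [c Hc] := choice gap.
have [m /andP[m0 _] mc] := finite_pos_lower_bound (fun p => (Hc p).1).
exists m => // i j y z ij Xy Xz.
by apply: (le_trans (mc (i, j))); apply: (Hc (i, j)).2.
Qed.

(** The word v grows as long as one cylinder contains all of [U] within X. If two points of [U] part
    after v, their distance is at least c a_v, whence a bound by delta. If no parting occurs, growth
    stops at a depth n where c a_v is at most eta. *)
Lemma cylinder_localize {c delta eta : R} {U} :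
  (forall i j y z, i != j -> X y -> X z -> c <= N (f i y - f j z)) ->
  (forall y z, U y -> U z -> N (y - z) <= delta) -> 0 < eta ->
  exists2 v, U `&` X `<=` cylinder v & c * weight a v <= Num.max delta eta.
Proof.
move=> Hc HU eta0.
have [m /andP[m0 m1] Hm] : exists2 m, 0 < m < 1 & forall i, m <= 1 - a i.
  by apply: finite_pos_lower_bound => i; rewrite subr_gt0 ratio_lt1.
have [n Hn] : exists n, c * (1 - m) ^+ n <= eta.
  have [c0|c0] := leP c 0.
    exists 0%N; rewrite expr0 mulr1; exact: (le_trans c0 (ltW eta0)).
  have /cvgr0_norm_lt /(_ (eta / c)) : (fun n => (1 - m) ^+ n) @ \oo --> 0.
    by apply: cvg_expr; rewrite gtr0_norm; lra.
  rewrite divr_gt0// => /(_ isT) [n _ /(_ n (leqnn n))] /=.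
  rewrite ger0_norm ?exprn_ge0//; last lra.
  by rewrite ltr_pdivlMr// mulrC => /ltW H; exists n.
have [c0|c0] := leP c 0.
  exists [::]; first by move=> y [_ Xy]; exists y.
  rewrite /weight big_nil mulr1 le_max (le_trans c0 (ltW eta0)) orbT//.
have [] : (exists2 v, size v = n & U `&` X `<=` cylinder v) \/
    (exists2 v, U `&` X `<=` cylinder v & c * weight a v <= delta).
- elim: n {Hn} => [|n [[v vn Uv]|IH]]; last by right.
    by left; exists [::] => // y [_ Xy]; exists y.
  have [[i Ui]|Hi] := pselect (exists i, U `&` X `<=` cylinder (rcons v i)).
    by left; exists (rcons v i) => //; rewrite size_rcons vn.
  right; exists v => //.
  have [[y [Uy Xy]]|U0] := pselect (exists y, (U `&` X) y); last first.
    have [i _] : exists i : L, True.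
      case: HX => -[x0 Xx0] _ XE; move: Xx0; rewrite XE => -[i _ _].
      by exists i.
    by case: Hi; exists i => z Uz; case: U0; exists z.
  have [i [y1 Xy1 y1E]] := cylinder_rcons _ _ (Uv y (conj Uy Xy)).
  have [z [Uz Xz] zi] : exists2 z, (U `&` X) z & ~ cylinder (rcons v i) z.
    apply: contrapT => Hz; apply: Hi; exists i => z Uz.
    by apply: contrapT => zi; apply: Hz; exists z.
  have [j [z1 Xz1 z1E]] := cylinder_rcons _ _ (Uv z (conj Uz Xz)).
  have ij : i != j.
    by apply/eqP => ij; apply: zi; rewrite ij; exists z1.
  apply: le_trans (HU y z Uy Uz).
  rewrite -y1E -z1E -!cats1 !word_map_cat word_map_dist mulrC.
  by apply: ler_wpM2l; [apply: weight_ge0; exact: ratio_ge0|exact: Hc].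
- move=> [v vn Uv]; exists v => //; rewrite le_max; apply/orP; right.
  apply: le_trans Hn; rewrite ler_pM2l// -vn -weight_cst.
  by apply: ler_weight => i; rewrite ratio_ge0; have := Hm i; lra.
- by move=> [v Uv cv]; exists v => //; rewrite le_max cv.
Qed.

(** The error e pays for sets of diameter 0, which lie in cylinders of arbitrarily small but
    positive size; eta is chosen with eta^s at most e, except for s = 0, where both powers are 1. *)
Lemma cylinder_gauge {c s e : R} {U} :
  (forall i j y z, i != j -> X y -> X z -> c <= N (f i y - f j z)) -> 0 < c ->
  0 <= s -> 0 < e -> (diam N U <= 1)%E -> U !=set0 ->
  exists2 v, U `&` X `<=` cylinder v &
    (((c * weight a v) `^ s)%:E <= gauge N s U + e%:E)%E.
Proof.
move=> Hc c0 s0 e0 U1 Uneq0.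
have [delta delta0 UE] : exists2 delta : R, 0 <= delta & diam N U = delta%:E.
  have Ufin : diam N U \is a fin_num.
    by rewrite ge0_fin_numE ?diam_ge0// (le_lt_trans U1)// ltry.
  by exists (fine (diam N U)); rewrite ?fineK// fine_ge0// diam_ge0.
have Ugauge : gauge N s U = (delta `^ s)%:E.
  by rewrite /gauge UE; case: eqP => // U0; rewrite U0 in Uneq0; case: Uneq0.
have [eta eta0 Heta] : exists2 eta, 0 < eta & Num.max delta eta `^ s <= delta `^ s + e.
  have [delta_gt0|] := ltP 0 delta.
    by exists delta => //; rewrite maxxx lerDl ltW.
  move=> delta_le0; have -> : delta = 0 by apply/eqP; rewrite eq_le delta_le0.
  have [->|sneq0] := eqVneq s 0; first by exists 1; rewrite ?powRr0 ?lerDl ?ltW.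
  exists (e `^ s^-1); first exact: powR_gt0.
  by rewrite max_r ?powR_ge0// -powRrM mulVf// (powRr1 (ltW e0)) lerDr powR_ge0.
have [|v Uv cv] := cylinder_localize Hc _ eta0 (U := U) (delta := delta).
  by apply/diam_ubP => //; rewrite UE.
exists v => //; rewrite Ugauge -EFinD lee_fin; apply: le_trans Heta.
apply: ge0_ler_powR => //; rewrite nnegrE.
  by rewrite mulr_ge0 ?ltW// weight_gt0// => i; exact: ratio_gt0.
by rewrite le_max delta0.
Qed.

(* The words of the cylinders covering X form a finite cut of the tree of
   words, by compactness. *)
Lemma sum_weight_cover_ge1 {p : L -> R} {v_ : nat -> seq L} {P : pred nat} :
  (forall i, 0 <= p i) -> 1 <= \sum_i p i ->
  (forall y, X y -> exists2 k, P k & cylinder (v_ k) y) ->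
  exists n, 1 <= \sum_(0 <= k < n | P k) weight p (v_ k).
Proof.
move=> p0 p1 Pv.
(* The complement of the other cylinders of the same level. It is open, and by disjointness it
   contains X_v for v = [v_ k]; within X it is no larger. *)
pose O k := ~` \bigcup_(w in [set w | size w = size (v_ k) /\ w <> v_ k]) cylinder w.
have [_ cX _] := HX.
have := cX; rewrite compact_cover => /(_ nat [set k | P k] O) [].
- move=> k _; apply: closed_openC; apply: closed_bigcup => [|w _].
    apply: (@sub_finite_set _ _ [set w : seq L | (size w <= size (v_ k))%N]).
      by move=> w /= [->].
    exact: finite_words.
  exact: cylinder_closed.
- move=> y Xy; have [k Pk yk] := Pv y Xy; exists k => // -[w [/= wk wv] yw].
  by apply: wv; apply: (cylinder_disjoint _ _ y).
move=> D' DP XD; pose D : seq nat := finmap.enum_fset D'.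
pose n := (\max_(k <- D) k).+1; exists n.
pose V := [seq v_ k | k <- index_iota 0 n & P k].
suff : 1 <= \sum_(v <- V) weight p v by rewrite big_map big_filter.
apply: (sum_weight_prefix_ge1 p (\max_(k <- D) size (v_ k))) => // w wn.
case: HX => -[x0 Xx0] _ _.
(* A word w of maximal length is tested by the point f_w x0: the set [O k] containing it shows that
   [v_ k] is a prefix of w. *)
have /XD [k /= kD yO] := attractor_word w x0 Xx0.
have kw : (size (v_ k) <= size w)%N by rewrite wn (leq_bigmax_seq k (F := fun k => size (v_ k))).
exists (v_ k).
  apply/mapP; exists k => //; rewrite mem_filter mem_index_iota /= ltnS.
  rewrite (leq_bigmax_seq k (F := id))// andbT.
  by have := DP k kD; rewrite inE.
rewrite prefixE; apply/eqP; apply: contrapT => wv; apply: yO.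
exists (take (size (v_ k)) w); first by split => //=; rewrite size_takel.
apply: (cylinder_cat _ (drop (size (v_ k)) w)).
by rewrite cat_take_drop; exists x0.
Qed.

(* Mass distribution principle without a measure: a cover of X with small gauge
   sum would give a finite cut of the tree of words of total weight less than 1. *)
Lemma hausdorff_measure_attractor_neq0 (s : R) : 0 <= s ->
  1 <= \sum_i a i `^ s -> hausdorff_measure N s X <> 0%E.
Proof.
move=> s0 as1 X0.
have [c c0 Hc] := separation_gap.
(* Half of c^s is for the gauge sum of the cover, the other half for the errors e / 2^(k+1) of the
   single cylinders. The total is below c^s, whereas the cut requires at least c^s. *)
pose e := c `^ s / 2.
have e0 : 0 < e by rewrite divr_gt0// powR_gt0.
have [U [XU U1 Ue]] := hausdorff_measure0_cover N s X e e0 X0.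
have vP k : exists v, (U k !=set0 -> U k `&` X `<=` cylinder v /\
    (((c * weight a v) `^ s)%:E <= gauge N s (U k) + (e / (2 ^ k.+1)%:R)%:E)%E).
  have [Uk|Uk] := pselect (U k !=set0); last by exists [::].
  have ek : 0 < e / (2 ^ k.+1)%:R by rewrite divr_gt0// ltr0n expn_gt0.
  by have [v Uv cv] := cylinder_gauge Hc c0 s0 ek (U1 k) Uk; exists v.
have [v_ Hv] := choice vP.
have [|n] := @sum_weight_cover_ge1 (fun i => a i `^ s) v_
    (fun k => `[< U k !=set0 >]) (fun i => powR_ge0 _ _) as1.
  move=> y Xy; have [k _ Uky] := XU y Xy.
  have Uk : U k !=set0 by exists y.
  by exists k; [exact/asboolP|apply: (Hv k Uk).1].
apply/negP; rewrite -ltNge -(ltr_pM2l (powR_gt0 s c0)) mulr1.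
rewrite -lte_fin mulr_sumr -sumEFin.
apply: (@le_lt_trans _ _
  (\sum_(0 <= k < n) (gauge N s (U k) + (e / (2 ^ k.+1)%:R)%:E))%E).
  rewrite big_mkcond; apply: lee_sum => k _; case: ifPn => [/asboolP Uk|_].
    rewrite weight_powR; last exact: ratio_ge0.
    rewrite -powRM; [exact: (Hv k Uk).2|exact: ltW|].
    by apply: weight_ge0; exact: ratio_ge0.
  by rewrite adde_ge0 ?gauge_ge0// lee_fin divr_ge0 ?ltW.
apply: (@le_lt_trans _ _
  (\sum_(k <oo) (gauge N s (U k) + (e / (2 ^ k.+1)%:R)%:E))%E).
  apply: nneseries_lim_ge => k _ _.
  by rewrite adde_ge0 ?gauge_ge0// lee_fin divr_ge0 ?ltW.
apply: (le_lt_trans (epsilon_trick xpredT (fun k => gauge_ge0 N s (U k)) (ltW e0))).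
rewrite (_ : c `^ s = e + e); last by rewrite /e; lra.
by rewrite EFinD lte_leD.
Qed.

(** If the sum exceeded 1 at d, it would still be at least 1 at some d + h with h > 0. Then no
    exponent below d + h would give X measure zero, against the definition of d as an infimum. *)
Lemma sum_powR_hausdorff_dim_le1 (d : R) :
  hausdorff_dim N X = d%:E -> \sum_i a i `^ d <= 1.
Proof.
move=> dE; rewrite leNgt; apply/negP => S1; set S := \sum_i _ in S1.
have [m /andP[m0 m1] Hm] := finite_pos_lower_bound ratio_gt0.
have lnm : 0 < - ln m by rewrite oppr_gt0 ln_lt0// m0.
(* Chosen so that m^h = 1/S; raising the exponent by h costs each term at most this factor. *)
pose h := ln S / (- ln m).
have h0 : 0 < h by rewrite divr_gt0// ln_gt0.
have : (hausdorff_dim N X < (d + h)%:E)%E by rewrite dE lte_fin ltrDl.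
move=> /ereal_inf_lt[_ [s [s0 Xs0] <-]]; rewrite lte_fin => sdh.
apply: (hausdorff_measure_attractor_neq0 s s0 _ Xs0).
apply: (@le_trans _ _ (\sum_i a i `^ (d + h))); last first.
  apply: ler_sum => i _; apply: ger_powR; last exact: ltW.
  by rewrite ratio_gt0 ltW// ratio_lt1.
apply: (@le_trans _ _ (S * m `^ h)).
  have -> : m `^ h = S^-1.
    rewrite /powR gt_eqF// /h.
    have -> : ln S / - ln m * ln m = - ln S.
      by field; rewrite -oppr_eq0 gt_eqF.
    by rewrite expRN lnK// posrE; apply: lt_trans S1.
  by rewrite divff// gt_eqF//; apply: lt_trans S1.
rewrite mulr_suml; apply: ler_sum => i _.
rewrite powRD; last by rewrite (gt_eqF (ratio_gt0 i)) implybT.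
by rewrite ler_wpM2l ?powR_ge0// ge0_ler_powR ?nnegrE ?ratio_ge0// (ltW h0, ltW m0).
Qed.

(** * Covering the targets *)

Lemma word_cut {m r : R} {w} : (forall i, m <= a i) -> 0 < r -> weight a w < r ->
  exists v u, [/\ w = v ++ u, weight a v < r & v = [::] \/ m * r <= weight a v].
Proof.
move=> ma r0; elim/last_ind: w => [|w i IH] wr.
  by exists [::], [::]; split => //; left.
have [/IH [v [u [-> vr vm]]]|rw] := ltP (weight a w) r.
  by exists v, (rcons u i); split => //; rewrite rcons_cat.
(* One letter earlier the weight was still at least r, and a letter costs at most the factor m. *)
exists (rcons w i), [::]; split => //; first by rewrite cats0.
right; rewrite weight_rcons mulrC.
apply: (@le_trans _ _ (r * a i)); first by rewrite ler_wpM2l// ltW.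
by rewrite ler_wpM2r ?ratio_ge0.
Qed.

(* If the ball at f_w x is larger than X_w, it is replaced by a ball of radius
   comparable to diam X_v at f_v x, v being the prefix of w at which X_v becomes
   as small as the ball.  The square root comes from T <= S -> T <= sqrt (T * S). *)
Lemma target_cover {d M m K theta : R} {p : L -> R} {w} {x y} :
  let q i := Num.sqrt (p i * a i `^ d) in
  0 < d -> (forall y z, X y -> X z -> N (y - z) <= M) -> 0 < m ->
  (forall i, m <= a i) -> 0 < K -> (forall i, 0 < p i <= theta ^+ 2) ->
  0 < theta -> X x -> X y ->
  N (y - word_map f w x) <= (K * weight p w) `^ d^-1 ->
  exists v u, w = v ++ u /\
    N (y - word_map f v x) <= (m^-1 + M + 1) *
      (Num.sqrt K * weight q v * theta ^+ size u) `^ d^-1.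
Proof.
move=> q d0 XM m0 ma K0 p0 theta0 Xx Xy.
have p_gt0 i : 0 < p i by case/andP: (p0 i).
have M0 : 0 <= M by apply: le_trans (XM x x Xx Xx); exact: is_norm_ge0.
have C1 : 1 <= m^-1 + M + 1 by rewrite lerDr addr_ge0// invr_ge0 ltW.
have q0 i : 0 <= q i by exact: sqrtr_ge0.
have a_gt0 v : 0 < weight a v by apply: weight_gt0; exact: ratio_gt0.
have wp_gt0 v : 0 < weight p v by exact: weight_gt0.
have d1_ge0 : 0 <= d^-1 by rewrite invr_ge0 ltW.
have qE v : weight q v ^+ 2 = weight p v * weight a v `^ d.
  rewrite -weight_powR; last exact: ratio_ge0.
  rewrite expr2 -!weightM; congr weight; apply/funext => i.
  by rewrite -expr2 sqr_sqrtr// mulr_ge0 ?powR_ge0// ltW.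
have powd v : (weight a v `^ d) `^ d^-1 = weight a v.
  by rewrite -powRrM divff ?powRr1 ?ltW// gt_eqF.
have leS v n T : 0 <= T -> T ^+ 2 <= K * weight p v * weight a v `^ d * (theta ^+ n) ^+ 2 ->
    T <= Num.sqrt K * weight q v * theta ^+ n.
  move=> T0 TS; rewrite -(@ler_pXn2r _ 2)// ?nnegrE//; last first.
    by rewrite !mulr_ge0 ?sqrtr_ge0 ?weight_ge0 ?exprn_ge0// ltW.
  by apply: (le_trans TS); rewrite !exprMn sqr_sqrtr ?(ltW K0)// qE !mulrA.
set T := K * weight p w.
have T0 : 0 < T by rewrite mulr_gt0.
have T0' : 0 < T `^ d^-1 by exact: powR_gt0.
(* Small ball: v = w and u is empty. Here T <= a_w^d, so T^2 <= K p_w a_w^d. *)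
move=> yw; have [Tw|wT] := leP (T `^ d^-1) (weight a w).
  exists w, [::]; split; first by rewrite cats0.
  apply: (le_trans yw); apply: (@le_trans _ _ (1 * T `^ d^-1)); first by rewrite mul1r.
  apply: ler_pM => //; first exact: ltW.
  have Twd : T <= weight a w `^ d.
    rewrite -[leLHS](_ : (T `^ d^-1) `^ d = T).
      by apply: ge0_ler_powR => //; rewrite ?nnegrE ltW.
    by rewrite -powRrM mulVf ?powRr1 ?(ltW T0)// gt_eqF.
  have TS : T <= Num.sqrt K * weight q w * theta ^+ 0.
    apply: leS; first exact: ltW.
    by rewrite expr0 expr1n mulr1 expr2 ler_wpM2l// ltW.
  by apply: ge0_ler_powR => //; rewrite nnegrE; [exact: ltW|exact: le_trans (ltW T0) TS].
(* Large ball: w is cut where a_v drops below T^(1/d). Then a_v^d <= T = K p_v p_u, and p_u <=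
   theta^(2|u|). *)
have [v [u [wE vT vm]]] := word_cut ma T0' wT.
exists v, u; split => //.
set S := Num.sqrt K * weight q v * theta ^+ size u.
have vS : weight a v `^ d <= S.
  apply: leS; first exact: powR_ge0.
  rewrite expr2 mulrAC; apply: ler_wpM2r; first exact: powR_ge0.
  apply: (@le_trans _ _ T).
    rewrite -[leRHS](_ : (T `^ d^-1) `^ d = T).
      by apply: ge0_ler_powR; rewrite ?nnegrE ?ltW.
    by rewrite -powRrM mulVf ?powRr1 ?(ltW T0)// gt_eqF.
  rewrite /T wE weight_cat mulrA; apply: ler_wpM2l; first by rewrite mulr_ge0 ?ltW.
  rewrite -exprM mulnC exprM -weight_cst; apply: ler_weight => i.
  by have /andP[p1 p2] := p0 i; rewrite (ltW p1).
have avS : weight a v <= S `^ d^-1.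
  rewrite -[leLHS]powd; apply: ge0_ler_powR => //; rewrite nnegrE ?powR_ge0//.
  exact: le_trans (powR_ge0 _ _) vS.
apply: (@le_trans _ _ ((m^-1 + M + 1) * weight a v)); last first.
  by rewrite ler_wpM2l// (le_trans ler01).
case: vm => [v0|vm].
  rewrite v0 /weight big_nil mulr1; apply: (le_trans (XM _ _ Xy Xx)).
  by rewrite addrAC lerDr addr_ge0// invr_ge0 ltW.
(* Passage through f_w x: the original radius is at most a_v / m by the cut, and f_w x lies in X_v,
   within M a_v of f_v x. *)
apply: (le_trans (is_norm_dist_triangle N HN _ (word_map f w x) _)).
rewrite {2}wE word_map_cat word_map_dist !mulrDl mul1r.
apply: ler_wpDr; first exact: ltW.
apply: lerD; last first.
  rewrite mulrC; apply: ler_wpM2r; first exact: ltW.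
  by apply: XM => //; exact: attractor_word.
by apply: (le_trans yw); rewrite -(ler_pM2l m0) mulrA divff ?gt_eqF// mul1r.
Qed.

Lemma hausdorff_measure_targets0 {d K theta : R} {p : L -> R}
    {Theta : seq L -> R} {n0 : nat} {x} :
  0 < d -> 0 < K -> (forall i, 0 < p i <= theta ^+ 2) -> 0 < theta < 1 ->
  \sum_i Num.sqrt (p i * a i `^ d) < 1 -> X x ->
  (forall w, (n0 <= size w)%N -> Theta w <= (K * weight p w) `^ d^-1) ->
  hausdorff_measure N d (limsup_set f N X x Theta) = 0%E.
Proof.
move=> d0 K0 p0 /andP[theta0 theta1] q1 Xx HTheta.
have [M M0 XM] := attractor_bounded.
have [m /andP[m0 m1] ma] := finite_pos_lower_bound ratio_gt0.
pose q i := Num.sqrt (p i * a i `^ d).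
pose C := m^-1 + M + 1.
have C0 : 0 <= C by rewrite !addr_ge0// ?invr_ge0 ltW.
pose S (z : seq L * nat) := Num.sqrt K * weight q z.1 * theta ^+ z.2.
have q0 i : 0 <= q i by exact: sqrtr_ge0.
have S0 (z : seq L * nat) : 0 <= S z.
  by rewrite !mulr_ge0 ?sqrtr_ge0 ?exprn_ge0 ?weight_ge0// ltW.
pose rho (z : seq L * nat) := C * S z `^ d^-1.
have rho0 (z : seq L * nat) : 0 <= rho z by rewrite mulr_ge0 ?powR_ge0.
(* The pairs (v, |u|) are enumerated by their codes. A number that codes no pair receives the empty
   set and the diameter bound 0. *)
pose E (k : nat) := if pickle_inv k is Some z then
  [set y | N (y - word_map f z.1 x) <= rho z] else set0.
pose r (k : nat) := oapp (fun z => 2 * rho z) 0 (pickle_inv k).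
pose B := (1 - \sum_i q i)^-1 / (1 - theta).
apply: (@hausdorff_measure_limsup0 _ _ N d ((2 * C) `^ d * Num.sqrt K * B) _ E r) => //.
- by move=> k; rewrite /r; case: pickle_inv => //= z; rewrite mulr_ge0.
- move=> k y z; rewrite /E /r; case: pickle_inv => //= u yu zu.
  apply: (le_trans (is_norm_dist_triangle N HN _ (word_map f u.1 x) _)).
  by rewrite mulr_natl mulr2n lerD// is_norm_distC.
- move=> n; rewrite (_ : \sum_(0 <= k < n) _ =
      \sum_(0 <= k < n) oapp (fun z => (2 * rho z) `^ d) 0 (pickle_inv k)); last first.
    apply: eq_bigr => k _; rewrite /r; case: pickle_inv => //=.
    by rewrite powR0// gt_eqF.
  rewrite -big_pmap (_ : \sum_(z <- _) _ = \sum_(z <- pmap pickle_inv (index_iota 0 n))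
      (2 * C) `^ d * Num.sqrt K * (weight q z.1 * theta ^+ z.2)); last first.
    apply: eq_bigr => z _; rewrite /rho mulrA powRM ?powR_ge0 ?mulr_ge0//.
    rewrite -powRrM mulVf ?gt_eqF// powRr1 ?S0// /S.
    by rewrite !mulrA.
  rewrite -mulr_sumr ler_wpM2l ?mulr_ge0 ?powR_ge0 ?sqrtr_ge0//.
  apply: sum_geometric_pairs_le.
  + by move=> v; exact: weight_ge0.
  + by rewrite ltW.
  + by move=> V; exact: sum_weight_uniq_le.
  + by apply: (pmap_uniq pickle_invK); rewrite iota_uniq.
- move=> y [Xy Winf] n.
  (* [n1] bounds |v| + |u| over the pairs with code below n. Hence a word w = v u longer than [n1]
     gives a pair with code at least n, and infinitely many targets supply such words. *)
  pose sz (k : nat) := oapp (fun z : seq L * nat => size z.1 + z.2)%N 0%N (pickle_inv k).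
  pose n1 := (\max_(k < n) sz k)%N.
  have [w /= wT wn] : exists2 w, N (y - word_map f w x) < Theta w &
      (maxn n0 n1 < size w)%N.
    apply: contrapT => Hw; apply: Winf.
    apply: (@sub_finite_set _ _ [set w : seq L | (size w <= maxn n0 n1)%N]).
      by move=> w /= wT; rewrite leqNgt; apply/negP => wn; apply: Hw; exists w.
    exact: finite_words.
  have wn0 : (n0 <= size w)%N by lia.
  have := target_cover (w := w) (theta := theta) d0 XM m0 ma K0 p0 theta0 Xx Xy.
  move=> [|v [u [wE yv]]]; first exact: le_trans (ltW wT) (HTheta w wn0).
  exists (pickle (v, size u)); last by rewrite /E pickleK_inv.
  rewrite leqNgt; apply/negP => kn.
  have : (sz (pickle (v, size u)) <= n1)%N.
    exact: (leq_bigmax (Ordinal kn) (F := fun k : 'I_n => sz k)).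
  by rewrite /sz pickleK_inv /= -size_cat -wE; lia.
Qed.

End Cylinders.

(** * Comparison of the weights p and mu, and the choice of constants *)

Lemma lt1_of_sum_le1 {R : numDomainType} {L : finType} {F : L -> R} :
  (forall i, 0 < F i) -> (exists i j : L, i != j) -> \sum_i F i <= 1 ->
  forall k, F k < 1.
Proof.
move=> F0 [i [j ij]] F1 k.
have [l lk] : exists l, l != k.
  by have [ik|ik] := eqVneq i k; [exists j; rewrite eq_sym -ik|exists i].
apply: lt_le_trans F1; rewrite (bigD1 k)//= ltrDl (bigD1 l)//=.
by rewrite ltr_wpDr// sumr_ge0// => n _; exact: ltW.
Qed.

Lemma powR_lt1_gt0 {R : realType} {a s : R} : 0 < a < 1 -> a `^ s < 1 -> 0 < s.
Proof.
move=> /andP[a0 a1] as1; rewrite ltNge; apply/negP => s0.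
suff : 1 <= a `^ s by rewrite leNgt as1.
by rewrite -(powRr0 a); apply: ger_powR => //; rewrite a0 ltW.
Qed.

(* Strict AM-GM at one index. *)
Lemma sum_sqrt_lt1 {R : realType} {L : finType} {p q : L -> R} :
  (forall i, 0 <= p i) -> (forall i, 0 <= q i) ->
  \sum_i p i <= 1 -> \sum_i q i <= 1 -> (exists i, p i != q i) ->
  \sum_i Num.sqrt (p i * q i) < 1.
Proof.
move=> p0 q0 p1 q1 [k pqk].
have amgm i : (p i + q i) / 2 - Num.sqrt (p i * q i) =
    (Num.sqrt (p i) - Num.sqrt (q i)) ^+ 2 / 2.
  rewrite sqrrB !sqr_sqrtr// sqrtrM//.
  by set u := Num.sqrt (p i); set v := Num.sqrt (q i); rewrite -mulr_natr; field.
apply: (@lt_le_trans _ _ (\sum_i (p i + q i) / 2)); last first.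
  by rewrite -mulr_suml big_split /= ler_pdivrMr// mul1r; lra.
rewrite (bigD1 k)//= [ltRHS](bigD1 k)//=; apply: ltr_leD.
  rewrite -subr_gt0 amgm divr_gt0// lt0r sqr_ge0 sqrf_eq0 andbT subr_eq0.
  by apply: contra pqk => /eqP pq; rewrite -(sqr_sqrtr (p0 k)) pq sqr_sqrtr.
by apply: ler_sum => i _; rewrite -subr_ge0 amgm divr_ge0// sqr_ge0.
Qed.

Theorem proposition3p2 (R : realType) (t : nat) (N : 'cV[R]_t -> R)
    (L : finType) (a : L -> R) (Q : L -> 'M[R]_t) (b : L -> 'cV[R]_t)
    (X : set 'cV[R]_t) (psi : nat -> R) (alpha s d : R) (x : 'cV[R]_t)
    (f := fun i : L => affine_map (a i) (Q i) (b i))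
    (Psi := target_radius f N X psi)
    (HN : is_norm N)
    (Ha : forall i, 0 < a i < 1)
    (HO : forall i, is_rotation (Q i))
    (Hconf : forall i y, N (Q i *m y) = N y)
    (HX : is_attractor f X)
    (Hsep : strong_separation f X)
    (Hne : exists i j : L, a i != a j)
    (Hpsi0 : forall n, 0 <= psi n)
    (Hpsi : nonincreasing_seq psi)
    (Halpha : shrinking_rate psi = alpha%:E)
    (Halpha0 : 0 < alpha)
    (Hs : \sum_(i : L) expR (- alpha * s) * (a i) `^ s = 1)
    (Hd : hausdorff_dim N X = d%:E)
    (Hx : X x) :
  hausdorff_measure N d
    (limsup_set f N X x (fun w => Psi w `^ (s / d))) = 0%E.
Proof.
have a_gt0 i : 0 < a i by case/andP: (Ha i).
have f_sim i y z : N (f i y - f i z) = a i * N (y - z).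
  rewrite /f /affine_map opprD addrACA subrr addr0 -scalerBr -mulmxBr.
  by rewrite (norm_homo HN) Hconf gtr0_norm.
have f_cont i : continuous (f i) by exact: affine_map_continuous.
have [i1 [j1 aij]] := Hne.
have Lij : exists i j : L, i != j.
  by exists i1, j1; apply: contraNneq aij => ->.
have mu1 := sum_powR_hausdorff_dim_le1 N a f X HN Ha f_sim f_cont HX Hsep d Hd.
pose mu i := a i `^ d; pose p i := expR (- alpha * s) * a i `^ s.
have mu0 i : 0 < mu i by exact: powR_gt0.
have p0 i : 0 < p i by rewrite mulr_gt0 ?expR_gt0 ?powR_gt0.
(* There are at least two letters, so every mu_i is below 1, which forces d > 0. *)
have d0 : 0 < d := powR_lt1_gt0 (Ha i1) (lt1_of_sum_le1 mu0 Lij mu1 i1).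
have p1 : \sum_i p i <= 1 by rewrite Hs.
have p_lt1 := lt1_of_sum_le1 p0 Lij p1.
have s0 : 0 < s.
  rewrite ltNge; apply/negP => s_le0.
  have : 1 <= p i1.
    rewrite -[leLHS]mulr1; apply: ler_pM => //.
      by rewrite -[leLHS]expR0 ler_expR mulNr oppr_ge0 pmulr_rle0.
    by rewrite -(powRr0 (a i1)); apply: ger_powR => //; rewrite a_gt0 ltW//; case/andP: (Ha i1).
  by rewrite leNgt p_lt1.
(* Equality for all i would give (s - d) ln a_i = alpha s. Two different ratios then force s = d,
   hence alpha s = 0. *)
have pmu : exists i, p i != mu i.
  apply: contrapT => H.
  have pE i : s * ln (a i) - alpha * s = d * ln (a i).
    have : p i = mu i by apply/eqP; apply: contrapT => /negP Hi; apply: H; exists i.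
    rewrite /p /mu /powR !gt_eqF// -expRD => /expR_inj <-; ring.
  have lnij : ln (a i1) != ln (a j1).
    by apply: contraNneq aij => /ln_inj ->//; rewrite posrE.
  have : (s - d) * (ln (a i1) - ln (a j1)) = 0.
    by have := pE i1; have := pE j1; lra.
  move/eqP; rewrite mulf_eq0 !subr_eq0 (negbTE lnij) orbF => /eqP sd.
  have : alpha * s = 0 by have := pE i1; rewrite sd; lra.
  by apply/eqP; rewrite gt_eqF// mulr_gt0.
have S1 := sum_sqrt_lt1 (fun i => ltW (p0 i)) (fun i => ltW (mu0 i)) p1 mu1 pmu.
set S := \sum_i _ in S1.
have [m /andP[m0 m1] pm] : exists2 m, 0 < m < 1 & forall i, m <= 1 - p i.
  by apply: finite_pos_lower_bound => i; rewrite subr_gt0.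
(* kappa < 1 bounds both the sum of sqrt (p_i mu_i) and every sqrt p_i. *)
pose kappa := Num.max S (Num.sqrt (1 - m)).
have sqrt1m : 0 < Num.sqrt (1 - m) < 1.
  apply/andP; split; first by rewrite sqrtr_gt0 subr_gt0.
  by rewrite -[ltRHS]sqrtr1 ltr_sqrt// ltrBlDr ltrDl.
have kappa0 : 0 < kappa by rewrite lt_max; case/andP: sqrt1m => -> _; rewrite orbT.
have kappa1 : kappa < 1 by rewrite gt_max S1; case/andP: sqrt1m.
(* The slack per letter: p'_i = p_i e^h = p_i / kappa is still at most kappa = theta^2, and the sum
   of sqrt (p'_i mu_i) is at most sqrt kappa < 1. *)
pose h := - ln kappa.
have h0 : 0 < h by rewrite oppr_gt0 ln_lt0// kappa0.
have expRh : expR h = kappa^-1 by rewrite expRN lnK.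
(* Lowering the rate by h / s costs, after raising to the power s, the factor e^(h n), which p'
   absorbs. *)
have [n0 Hn0] : exists n0, forall n, (n0 <= n)%N ->
    psi n <= expR (- (alpha - h / s) * n%:R).
  apply: shrinking_rate_lt => //.
  by rewrite -/(shrinking_rate psi) Halpha lte_fin ltrBlDr ltrDl divr_gt0.
have [M M0 XM] := attractor_bounded N f X HN HX.
pose p' i := p i * expR h.
apply: (hausdorff_measure_targets0 N a f X HN Ha f_sim HX (n0 := n0)
  (K := M `^ s) (theta := Num.sqrt kappa) (p := p')) => //.
- exact: powR_gt0.
- move=> i; rewrite mulr_gt0 ?expR_gt0//= sqr_sqrtr ?(ltW kappa0)//.
  rewrite /p' expRh ler_pdivrMr// -expr2.
  apply: (@le_trans _ _ (1 - m)); first by have := pm i; lra.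
  rewrite -[leLHS](@sqr_sqrtr _ (1 - m)); last lra.
  by rewrite ler_pXn2r ?nnegrE ?sqrtr_ge0 ?(ltW kappa0)// le_max lexx orbT.
- by rewrite sqrtr_gt0 kappa0 -[ltRHS]sqrtr1 ltr_sqrt.
- rewrite (eq_bigr (fun i => Num.sqrt (p i * mu i) * Num.sqrt (expR h))); last first.
    move=> i _; rewrite /p' mulrAC sqrtrM //.
    exact: (mulr_ge0 (ltW (p0 i)) (ltW (mu0 i))).
  rewrite -mulr_suml -/S expRh.
  apply: (@le_lt_trans _ _ (kappa * Num.sqrt kappa^-1)).
    by rewrite ler_wpM2r ?sqrtr_ge0// le_max lexx.
  rewrite -[X in X * _](sqr_sqrtr (ltW kappa0)) expr2 -mulrA -sqrtrM ?(ltW kappa0)//.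
  by rewrite divff ?gt_eqF// sqrtr1 mulr1 -[ltRHS]sqrtr1 ltr_sqrt.
- move=> w wn; rewrite powRrM; apply: ge0_ler_powR.
  + by rewrite invr_ge0 ltW.
  + by rewrite nnegrE powR_ge0.
  + by rewrite nnegrE mulr_ge0 ?powR_ge0// weight_ge0// => i; rewrite mulr_ge0 ?ltW ?expR_gt0.
  (* It remains to bound Psi(w)^s by M^s p'_w; the outer power 1/d has been removed by
     monotonicity. *)
  have aw0 : 0 <= weight a w by apply: weight_ge0 => i; exact: ltW.
  have Psi_le : Psi w <= M * weight a w * expR (- (alpha - h / s) * (size w)%:R).
    apply: ler_pM => //; last exact: Hn0.
      by rewrite fine_ge0// diam_ge0.
    have wdiam : (diam N (word_map f w @` X) <= (M * weight a w)%:E)%E.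
      apply/diam_ubP; first by rewrite mulr_ge0// ltW.
      move=> _ _ [y Xy <-] [z Xz <-].
      by rewrite (word_map_dist N a f f_sim) mulrC ler_wpM2r// XM.
    rewrite -lee_fin fineK// ge0_fin_numE ?diam_ge0//.
    exact: le_lt_trans wdiam (ltry _).
  apply: (@le_trans _ _ ((M * weight a w * expR (- (alpha - h / s) * (size w)%:R)) `^ s)).
    apply: ge0_ler_powR Psi_le; first exact: ltW.
      by rewrite nnegrE mulr_ge0// fine_ge0// diam_ge0.
    by rewrite nnegrE !mulr_ge0 ?expR_ge0// ltW.
  have M0' := ltW M0.
  rewrite !powRM ?expR_ge0 ?mulr_ge0// -mulrA ler_wpM2l ?powR_ge0//.
  rewrite /p' !weightM !weight_cst weight_powR; last by move=> i; exact: ltW.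
  rewrite mulrAC mulrC ler_wpM2r ?powR_ge0//.
  rewrite /powR gt_eqF ?expR_gt0// expRK -!expRM_natl -expRD ler_expR.
  rewrite (_ : s * _ = (- alpha * s + h) * (size w)%:R).
    by rewrite mulrDl [leRHS]addrC; lra.
  by field; rewrite gt_eqF.
Qed.
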